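(* Let $A\in\mathcal S_n$, $C\in\mathcal S_m$, $E\in\mathcal S_p$, $B\in\mathbb R^{m\times n}$, $D\in\mathbb R^{p\times m}$, $f\in\mathbb R^n$, $g\in\mathbb R^m$, $h\in\mathbb R^p$ be such that the coefficient matrix of the double saddle point problem $$\begin{bmatrix} A & B^T & 0 \\ B & -C & D^T \\ 0 & D & E \end{bmatrix}\begin{bmatrix} x \\ y \\ z \end{bmatrix}=\begin{bmatrix} f \\ g \\ h \end{bmatrix}$$ is nonsingular. Let $[\tilde x^T,\tilde y^T,\tilde z^T]^T$ with $\tilde x\in\mathbb R^n,\tilde y\in\mathbb R^m,\tilde z\in\mathbb R^p$ be an approximate solution of this system (i.e. any given vector), and let $\theta_1,\theta_2,\theta_4,\theta_5,\theta_7,\theta_8,\theta_9,\theta_{10}\ge 0$ with $\theta_8,\theta_9,\theta_{10}\neq 0$. Then the sparsity-preserving structured backward error satisfies $$\eta^{\mathbb S_1}_{\rm sps}(\tilde x,\tilde y,\tilde z)=\left\|\mathcal J^T(\mathcal J\mathcal J^T)^{-1}R\right\|_2,$$ where $R=[R_f^T,R_g^T,R_h^T]^T$, $R_f=f-A\tilde x-B^T\tilde y$, $R_g=g-B\tilde x+C\tilde y-D^T\tilde z$, $R_h=h-D\tilde y-E\tilde z$, and $\mathcal J=[\widetilde{\mathcal J}\;\;\mathcal I]\in\mathbb R^{(n+m+p)\times l}$, $l=\mu+\sigma+\tau+mn+mp+n+m+p$, with $$\widetilde{\mathcal J}=\begin{bmatrix} \frac1{\theta_1}\mathcal K_{\tilde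 x}\Phi_A\mathfrak D_{\mathcal S_n}^{-1} & \frac1{\theta_2}\mathcal N^n_{\tilde y}\Phi_B & 0 & 0 & 0 \\ 0 & \frac1{\theta_2}\mathcal M^m_{\tilde x}\Phi_B & -\frac1{\theta_4}\mathcal K_{\tilde y}\Phi_C\mathfrak D_{\mathcal S_m}^{-1} & \frac1{\theta_5}\mathcal N^m_{\tilde z}\Phi_D & 0 \\ 0 & 0 & 0 & \frac1{\theta_5}\mathcal M^p_{\tilde y}\Phi_D & \frac1{\theta_7}\mathcal K_{\tilde z}\Phi_E\mathfrak D_{\mathcal S_p}^{-1} \end{bmatrix},\qquad \mathcal I=\begin{bmatrix} -\frac1{\theta_8}I_n & 0 & 0 \\ 0 & -\frac1{\theta_9}I_m & 0 \\ 0 & 0 & -\frac1{\theta_{10}}I_p \end{bmatrix}.$$ Moreover, write $v=\mathcal J^T(\mathcal J\mathcal J^T)^{-1}R\in\mathbb R^l$ and partition $v=[v_1^T,\dots,v_8^T]^T$ into consecutive blocks of lengths $\mu,mn,\sigma,mp,\tau,n,m,p$. Then minimal perturbations (sparsity-preserving structured perturbations at which the minimum defining $\eta^{\mathbb S_1}_{\rm sps}(\tilde x,\tilde y,\tilde z)$ is attained) are given by $$\mathrm{vec}_{\mathcal S}(\widehat{\Delta A})=\theta_1^{-1}\mathfrak D_{\mathcal S_n}^{-1}v_1,\quad \mathrm{vec}(\widehat{\Delta B})=\theta_2^{-1}v_2,\quad \mathrm{vec}_{\mathcal S}(\widehat{\Delta C})=\theta_4^{-1}\mathfrak D_{\mathcal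 S_m}^{-1}v_3,\quad \mathrm{vec}(\widehat{\Delta D})=\theta_5^{-1}v_4,$$ $$\mathrm{vec}_{\mathcal S}(\widehat{\Delta E})=\theta_7^{-1}\mathfrak D_{\mathcal S_p}^{-1}v_5,\quad \widehat{\Delta f}=\theta_8^{-1}v_6,\quad \widehat{\Delta g}=\theta_9^{-1}v_7,\quad \widehat{\Delta h}=\theta_{10}^{-1}v_8.$$
   Context: Notation. $\mathcal S_k$ is the set of real symmetric $k\times k$ matrices; $\mu=\frac{n(n+1)}2$, $\sigma=\frac{m(m+1)}2$, $\tau=\frac{p(p+1)}2$. $\odot$ is the Hadamard (entrywise) product. For a real matrix $X=[x_{ij}]$, $\Theta_X$ is the matrix of the same size whose $(i,j)$ entry is $1$ if $x_{ij}\ne0$ and $0$ if $x_{ij}=0$. $\mathrm{vec}(X)$ stacks the columns of $X$. For $X\in\mathcal S_k$, $\mathrm{vec}_{\mathcal S}(X)\in\mathbb R^{k(k+1)/2}$ stacks the lower-triangular parts of the columns: $(x_{11},x_{21},\dots,x_{k1},x_{22},x_{32},\dots,x_{k2},\dots,x_{kk})^T$. $\Phi_X=\mathrm{diag}(\mathrm{vec}_{\mathcal S}(\Theta_X))$ for $X\in\{A,C,E\}$ and $\Phi_X=\mathrm{diag}(\mathrm{vec}(\Theta_X))$ for $X\in\{B,D\}$. $\mathfrak D_{\mathcal S_k}$ is the diagonal matrix of size $\frac{k(k+1)}2$ whose diagonal entry is $1$ at the positions in $\mathrm{vec}_{\mathcal S}$ of the diagonal entries $x_{ii}$ (positions $\frac{(2k-(i-2))(i-1)}2+1$,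 $i=1,\dots,k$) and $\sqrt2$ at all other positions. For $x\in\mathbb R^k$, $\mathcal K_x=[K_x^1\;K_x^2\;\cdots\;K_x^k]\in\mathbb R^{k\times k(k+1)/2}$, where $K_x^i\in\mathbb R^{k\times(k-i+1)}$ has first $i-1$ rows zero, $i$-th row equal to $(x_i,x_{i+1},\dots,x_k)$, and, for $r=i+1,\dots,k$, $r$-th row having the single nonzero entry $x_i$ in column $r-i+1$. For $x\in\mathbb R^{b}$, $\mathcal M^{a}_x=[x_1I_a\;x_2I_a\;\cdots\;x_bI_a]\in\mathbb R^{a\times ab}$. For $y\in\mathbb R^{a}$, $\mathcal N^{b}_y\in\mathbb R^{b\times ab}$ is the block diagonal matrix with $b$ diagonal blocks each equal to the row $y^T$. Conventions on weights. The $\theta_i$ are nonnegative reals, with $\frac1{\theta_i}=\theta_i^{-1}:=0$ if $\theta_i=0$; $\theta_i=0$ means that the corresponding block is not perturbed (its perturbation is required to be zero). Structured backward error. $\mathbb S_1$ is the set of tuples $(\Delta A,\Delta B,\Delta C,\Delta D,\Delta E,\Delta f,\Delta g,\Delta h)$ with $\Delta A\in\mathcal S_n$, $\Delta B\in\mathbb R^{m\times n}$, $\Delta C\in\mathcal S_m$, $\Delta D\in\mathbb R^{p\times m}$, $\Delta E\in\mathcal S_p$, $\Delta f\in\mathbb R^n$, $\Delta g\in\mathbb R^m$, $\Delta h\in\mathbb R^p$ such that $$\begin{bmatrix} A+\Delta A & (B+\Delta B)^T & 0 \\ B+\Delta B & -(C+\Delta C) & (D+\Delta D)^T \\ 0 &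 D+\Delta D & E+\Delta E \end{bmatrix}\begin{bmatrix} \tilde x \\ \tilde y \\ \tilde z \end{bmatrix}=\begin{bmatrix} f+\Delta f \\ g+\Delta g \\ h+\Delta h \end{bmatrix}.$$ $\eta^{\mathbb S_1}_{\rm sps}(\tilde x,\tilde y,\tilde z)$ is the minimum of $$\left(\theta_1^2\|\Delta A\|_F^2+\theta_2^2\|\Delta B\|_F^2+\theta_4^2\|\Delta C\|_F^2+\theta_5^2\|\Delta D\|_F^2+\theta_7^2\|\Delta E\|_F^2+\theta_8^2\|\Delta f\|_2^2+\theta_9^2\|\Delta g\|_2^2+\theta_{10}^2\|\Delta h\|_2^2\right)^{1/2}$$ over all tuples in $\mathbb S_1$ whose matrix perturbations preserve the sparsity pattern, i.e. $\Delta X=\Delta X\odot\Theta_X$ for $X\in\{A,B,C,D,E\}$. *)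

(* Defs.v *)
From mathcomp Require Import all_boot all_order all_algebra.

Set Implicit Arguments.
Unset Strict Implicit.
Unset Printing Implicit Defensive.

Import Order.TTheory GRing.Theory Num.Theory.

Local Open Scope ring_scope.

(* The reals are an arbitrary real closed field R. Inverses of weights rely on
   0^-1 = 0 in MathComp, which is the convention 1/theta = 0 for theta = 0. *)

(* vec and vecS are built with \mxcol, so their lengths are iterated sums of
   block lengths; vec_sizeE and svec_sizeE give the closed forms. *)
Notation vec_size m n := (\sum_(j < n) m)%N.
Notation svec_size k := (\sum_(i < k) (k - i)%N)%N.

Lemma vec_sizeE (m n : nat) : vec_size m n = (m * n)%N.
Proof. by rewrite sum_nat_const card_ord mulnC. Qed.

Lemma svec_sizeE (k : nat) : svec_size k = (k * k.+1)./2.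
Proof.
rewrite -(big_mkord xpredT (fun i => (k - i)%N)).
have -> : (\sum_(0 <= i < k) (k - i) = \sum_(0 <= i < k.+1) i)%N.
  rewrite [RHS]big_nat_rev [RHS]big_nat_recr // add0n subnn [RHS]addn0.
  by apply: eq_bigr => i _; rewrite subSS.
by rewrite bin2_sum bin2 mulnC.
Qed.

Lemma low_ord_subproof (k : nat) (i : 'I_k) (c : 'I_(k - i)) : (i + c < k)%N.
Proof. by rewrite -ltn_subRL. Qed.

(* Row index of the c-th entry, counted from the diagonal, of the
   lower-triangular part of column i. *)
Definition low_ord (k : nat) (i : 'I_k) (c : 'I_(k - i)) : 'I_k :=
  Ordinal (low_ord_subproof c).

Definition vec (R : rcfType) (m n : nat) (X : 'M[R]_(m, n)) :
    'cV[R]_(vec_size m n) :=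
  \mxcol_(j < n) col j X.

Definition vecS (R : rcfType) (k : nat) (X : 'M[R]_k) : 'cV[R]_(svec_size k) :=
  \mxcol_(i < k) (\col_(c < k - i) X (low_ord c) i).

Definition hadamard (R : rcfType) (m n : nat) (X Y : 'M[R]_(m, n)) :
    'M[R]_(m, n) :=
  map2_mx *%R X Y.

Definition Theta (R : rcfType) (m n : nat) (X : 'M[R]_(m, n)) : 'M[R]_(m, n) :=
  map_mx (fun a => (a != 0)%:R) X.

Definition Phi (R : rcfType) (m n : nat) (X : 'M[R]_(m, n)) :
    'M[R]_(vec_size m n) :=
  diag_mx (vec (Theta X))^T.

Definition PhiS (R : rcfType) (k : nat) (X : 'M[R]_k) : 'M[R]_(svec_size k) :=
  diag_mx (vecS (Theta X))^T.

(* The positions of diagonal and off-diagonal entries are read off by applying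
   vecS to the matrix with 1 on the diagonal and sqrt 2 elsewhere. *)
Definition DS (R : rcfType) (k : nat) : 'M[R]_(svec_size k) :=
  diag_mx (vecS (\matrix_(r < k, c < k)
                   (if r == c then 1 else Num.sqrt 2 : R)))^T.

Definition Kblock (R : rcfType) (k : nat) (x : 'cV[R]_k) (i : 'I_k) :
    'M[R]_(k, k - i) :=
  \matrix_(r < k, c < k - i)
    (if (r < i)%N then 0
     else if r == i then x (low_ord c) 0
     else if (c == r - i :> nat)%N then x i 0 else 0).

Definition Kmx (R : rcfType) (k : nat) (x : 'cV[R]_k) :
    'M[R]_(k, svec_size k) :=
  \mxrow_(i < k) Kblock x i.

Definition Mmx (R : rcfType) (a b : nat) (x : 'cV[R]_b) :
    'M[R]_(a, vec_size a b) :=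
  \mxrow_(j < b) (x j 0)%:M.

(* Block diagonal: the j-th block column has y^T in row j, zeros elsewhere. *)
Definition Nmx (R : rcfType) (b a : nat) (y : 'cV[R]_a) :
    'M[R]_(b, vec_size a b) :=
  \mxrow_(j < b) (\matrix_(r < b, c < a) (if r == j then y c 0 else 0)).

(* On column vectors this is the Euclidean norm. *)
Definition fnorm (R : rcfType) (m n : nat) (X : 'M[R]_(m, n)) : R :=
  Num.sqrt (\sum_(i < m) \sum_(j < n) X i j ^+ 2).

(* Blocks of a double saddle point system; also used for perturbations. *)
Record dsp (R : rcfType) (n m p : nat) : Type := DSP {
  blkA : 'M[R]_n;
  blkB : 'M[R]_(m, n);
  blkC : 'M[R]_m;
  blkD : 'M[R]_(p, m);
  blkE : 'M[R]_p;
  rhsf : 'cV[R]_n;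
  rhsg : 'cV[R]_m;
  rhsh : 'cV[R]_p
}.

Definition dsp_add (R : rcfType) (n m p : nat) (P Q : dsp R n m p) :
    dsp R n m p :=
  DSP (blkA P + blkA Q) (blkB P + blkB Q) (blkC P + blkC Q)
      (blkD P + blkD Q) (blkE P + blkE Q)
      (rhsf P + rhsf Q) (rhsg P + rhsg Q) (rhsh P + rhsh Q).

Record weights (R : rcfType) : Type := Weights {
  th1 : R; th2 : R; th4 : R; th5 : R; th7 : R; th8 : R; th9 : R; th10 : R
}.

Definition stack3 (R : rcfType) (n m p : nat)
    (x : 'cV[R]_n) (y : 'cV[R]_m) (z : 'cV[R]_p) : 'cV[R]_(n + m + p) :=
  col_mx (col_mx x y) z.

Definition coefmx (R : rcfType) (n m p : nat) (P : dsp R n m p) :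
    'M[R]_(n + m + p) :=
  block_mx
    (block_mx (blkA P) (blkB P)^T
              (blkB P) (- blkC P))  (col_mx 0 (blkD P)^T)
    (row_mx 0 (blkD P))             (blkE P).

Definition rhs (R : rcfType) (n m p : nat) (P : dsp R n m p) :
    'cV[R]_(n + m + p) :=
  stack3 (rhsf P) (rhsg P) (rhsh P).

Definition inS1 (R : rcfType) (n m p : nat) (P : dsp R n m p)
    (x : 'cV[R]_n) (y : 'cV[R]_m) (z : 'cV[R]_p) (Q : dsp R n m p) : Prop :=
  [/\ (blkA Q)^T = blkA Q, (blkC Q)^T = blkC Q, (blkE Q)^T = blkE Q &
      coefmx (dsp_add P Q) *m stack3 x y z = rhs (dsp_add P Q)].

Definition preserves_sparsity (R : rcfType) (n m p : nat)
    (P Q : dsp R n m p) : Prop :=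
  [/\ blkA Q = hadamard (blkA Q) (Theta (blkA P)),
      blkB Q = hadamard (blkB Q) (Theta (blkB P)),
      blkC Q = hadamard (blkC Q) (Theta (blkC P)),
      blkD Q = hadamard (blkD Q) (Theta (blkD P)) &
      blkE Q = hadamard (blkE Q) (Theta (blkE P))].

(* A zero weight means that the corresponding block is not perturbed. *)
Definition respects_zero_weights (R : rcfType) (n m p : nat) (w : weights R)
    (Q : dsp R n m p) : Prop :=
  [/\ th1 w = 0 -> blkA Q = 0, th2 w = 0 -> blkB Q = 0,
      th4 w = 0 -> blkC Q = 0, th5 w = 0 -> blkD Q = 0 &
      th7 w = 0 -> blkE Q = 0] /\
  [/\ th8 w = 0 -> rhsf Q = 0, th9 w = 0 -> rhsg Q = 0 &
      th10 w = 0 -> rhsh Q = 0].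

Definition admissible (R : rcfType) (n m p : nat) (P : dsp R n m p)
    (w : weights R) (x : 'cV[R]_n) (y : 'cV[R]_m) (z : 'cV[R]_p)
    (Q : dsp R n m p) : Prop :=
  [/\ inS1 P x y z Q, preserves_sparsity P Q & respects_zero_weights w Q].

Definition pert_norm (R : rcfType) (n m p : nat) (w : weights R)
    (Q : dsp R n m p) : R :=
  Num.sqrt (th1 w ^+ 2 * fnorm (blkA Q) ^+ 2 +
            th2 w ^+ 2 * fnorm (blkB Q) ^+ 2 +
            th4 w ^+ 2 * fnorm (blkC Q) ^+ 2 +
            th5 w ^+ 2 * fnorm (blkD Q) ^+ 2 +
            th7 w ^+ 2 * fnorm (blkE Q) ^+ 2 +
            th8 w ^+ 2 * fnorm (rhsf Q) ^+ 2 +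
            th9 w ^+ 2 * fnorm (rhsg Q) ^+ 2 +
            th10 w ^+ 2 * fnorm (rhsh Q) ^+ 2).

Definition minimal_perturbation (R : rcfType) (n m p : nat) (P : dsp R n m p)
    (w : weights R) (x : 'cV[R]_n) (y : 'cV[R]_m) (z : 'cV[R]_p)
    (Q : dsp R n m p) : Prop :=
  admissible P w x y z Q /\
  forall Q' : dsp R n m p,
    admissible P w x y z Q' -> pert_norm w Q <= pert_norm w Q'.

(* "eta is the structured backward error", i.e. the minimum of pert_norm over
   the admissible perturbations exists and equals eta. *)
Definition sps_backward_error (R : rcfType) (n m p : nat) (P : dsp R n m p)
    (w : weights R) (x : 'cV[R]_n) (y : 'cV[R]_m) (z : 'cV[R]_p)
    (eta : R) : Prop :=
  exists2 Q : dsp R n m p,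
    minimal_perturbation P w x y z Q & pert_norm w Q = eta.

Definition residual (R : rcfType) (n m p : nat) (P : dsp R n m p)
    (x : 'cV[R]_n) (y : 'cV[R]_m) (z : 'cV[R]_p) : 'cV[R]_(n + m + p) :=
  stack3 (rhsf P - blkA P *m x - (blkB P)^T *m y)
         (rhsg P - blkB P *m x + blkC P *m y - (blkD P)^T *m z)
         (rhsh P - blkD P *m y - blkE P *m z).

Definition row5 (R : rcfType) (k a b c d e : nat)
    (X1 : 'M[R]_(k, a)) (X2 : 'M[R]_(k, b)) (X3 : 'M[R]_(k, c))
    (X4 : 'M[R]_(k, d)) (X5 : 'M[R]_(k, e)) : 'M[R]_(k, a + b + c + d + e) :=
  row_mx (row_mx (row_mx (row_mx X1 X2) X3) X4) X5.

Definition Jtilde (R : rcfType) (n m p : nat) (P : dsp R n m p)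
    (w : weights R) (x : 'cV[R]_n) (y : 'cV[R]_m) (z : 'cV[R]_p) :
    'M[R]_(n + m + p,
           svec_size n + vec_size m n + svec_size m + vec_size p m
           + svec_size p) :=
  col_mx (col_mx
    (row5 ((th1 w)^-1 *: (Kmx x *m PhiS (blkA P) *m invmx (DS R n)))
          ((th2 w)^-1 *: (Nmx n y *m Phi (blkB P)))
          0
          0
          0)
    (row5 0
          ((th2 w)^-1 *: (Mmx m x *m Phi (blkB P)))
          (- ((th4 w)^-1 *: (Kmx y *m PhiS (blkC P) *m invmx (DS R m))))
          ((th5 w)^-1 *: (Nmx m z *m Phi (blkD P)))
          0))
    (row5 0
          0
          0
          ((th5 w)^-1 *: (Mmx p y *m Phi (blkD P)))
          ((th7 w)^-1 *: (Kmx z *m PhiS (blkE P) *m invmx (DS R p)))).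

Definition Icalmx (R : rcfType) (n m p : nat) (w : weights R) :
    'M[R]_(n + m + p) :=
  block_mx
    (block_mx (- (th8 w)^-1)%:M 0
              0                 (- (th9 w)^-1)%:M) 0
    0                                              (- (th10 w)^-1)%:M.

Definition Jmx (R : rcfType) (n m p : nat) (P : dsp R n m p)
    (w : weights R) (x : 'cV[R]_n) (y : 'cV[R]_m) (z : 'cV[R]_p) :
    'M[R]_(n + m + p,
           svec_size n + vec_size m n + svec_size m + vec_size p m
           + svec_size p + (n + m + p)) :=
  row_mx (Jtilde P w x y z) (Icalmx n m p w).

Definition stack8 (R : rcfType) (a b c d e n m p : nat)
    (v1 : 'cV[R]_a) (v2 : 'cV[R]_b) (v3 : 'cV[R]_c) (v4 : 'cV[R]_d)
    (v5 : 'cV[R]_e) (v6 : 'cV[R]_n) (v7 : 'cV[R]_m) (v8 : 'cV[R]_p) :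
    'cV[R]_(a + b + c + d + e + (n + m + p)) :=
  col_mx (col_mx (col_mx (col_mx (col_mx v1 v2) v3) v4) v5) (stack3 v6 v7 v8).

(* Main.v *)
Require Import Defs.
From mathcomp Require Import all_boot all_order all_algebra.
From mathcomp Require Import ring.

Set Implicit Arguments.
Unset Strict Implicit.
Unset Printing Implicit Defensive.

Import Order.TTheory GRing.Theory Num.Theory.

Local Open Scope ring_scope.

(* Weighting and vectorizing the blocks of a perturbation turns the weighted
   Frobenius norm into the Euclidean norm of one long vector u, and turns the
   perturbed system into the linear system J u = R; J has full row rank because
   its last block is invertible. The least-norm solution v = J^T (J J^T)^-1 R
   is orthogonal to every difference of two solutions, so its norm bounds the
   norm of every admissible perturbation from below. Conversely every vector in
   the range of J^T, in particular v, is itself the vectorization of a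
   sparsity-preserving perturbation, so the bound is attained. *)

(** * Frobenius norms, Gram matrices and least-norm solutions *)

Section FrobeniusNorm.
Variable R : rcfType.

Lemma fnorm_sqr (m n : nat) (X : 'M[R]_(m, n)) :
  fnorm X ^+ 2 = \sum_i \sum_j X i j ^+ 2.
Proof.
rewrite sqr_sqrtr // sumr_ge0 // => i _.
by rewrite sumr_ge0 // => j _; rewrite sqr_ge0.
Qed.

Lemma fnorm_ge0 (m n : nat) (X : 'M[R]_(m, n)) : 0 <= fnorm X.
Proof. exact: sqrtr_ge0. Qed.

Lemma fnorm_sqr_cV (k : nat) (u : 'cV[R]_k) : fnorm u ^+ 2 = (u^T *m u) 0 0.
Proof.
by rewrite fnorm_sqr mxE; apply: eq_bigr => i _; rewrite big_ord1 !mxE expr2.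
Qed.

Lemma gram_cV_eq0 (k : nat) (u : 'cV[R]_k) : u^T *m u = 0 -> u = 0.
Proof.
move=> u0; have := fnorm_sqr_cV u; rewrite u0 mxE fnorm_sqr => /eqP.
rewrite psumr_eq0 => [/allP u_eq0|i _]; last by rewrite big_ord1 sqr_ge0.
apply/colP => i; have := u_eq0 i (mem_index_enum i).
by rewrite big_ord1 sqrf_eq0 mxE => /eqP.
Qed.

Lemma fnorm_scale_sqr (m n : nat) (t : R) (X : 'M[R]_(m, n)) :
  fnorm (t *: X) ^+ 2 = t ^+ 2 * fnorm X ^+ 2.
Proof.
rewrite !fnorm_sqr mulr_sumr; apply: eq_bigr => i _.
by rewrite mulr_sumr; apply: eq_bigr => j _; rewrite mxE exprMn.
Qed.

Lemma fnorm_col_mx_sqr (k l : nat) (u : 'cV[R]_k) (v : 'cV[R]_l) :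
  fnorm (col_mx u v) ^+ 2 = fnorm u ^+ 2 + fnorm v ^+ 2.
Proof. by rewrite !fnorm_sqr_cV tr_col_mx mul_row_col mxE. Qed.

Lemma fnorm_mxcol_sqr (k : nat) (d : 'I_k -> nat) (u : forall i, 'cV[R]_(d i)) :
  fnorm (\mxcol_i u i) ^+ 2 = \sum_i fnorm (u i) ^+ 2.
Proof.
rewrite fnorm_sqr_cV tr_mxcol mul_mxrow_mxcol summxE.
by apply: eq_bigr => i _; rewrite fnorm_sqr_cV.
Qed.

(** If [u J J^T = 0], then [(u J)(u J)^T = 0] is a vanishing sum of squares, so [u J = 0], and
    independence of the rows of [J] forces [u = 0]. *)
Lemma gram_unitmx (k l : nat) (J : 'M[R]_(k, l)) :
  row_free J -> J *m J^T \in unitmx.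
Proof.
move=> freeJ; rewrite -row_free_unit; apply: inj_row_free => u uJJ0.
apply/(row_free_inj freeJ); rewrite mul0mx; apply: trmx_inj; rewrite trmx0.
by apply: gram_cV_eq0; rewrite trmxK trmx_mul mulmxA -(mulmxA u) uJJ0 mul0mx.
Qed.

Definition least_norm_sol (k l : nat) (J : 'M[R]_(k, l)) (r : 'cV[R]_k) :=
  J^T *m invmx (J *m J^T) *m r.

Lemma least_norm_solP (k l : nat) (J : 'M[R]_(k, l)) (r : 'cV[R]_k) :
  J *m J^T \in unitmx -> J *m least_norm_sol J r = r.
Proof. by move=> JJu; rewrite /least_norm_sol !mulmxA mulmxV // mul1mx. Qed.

(* Pythagoras: the least-norm solution lies in the row space of [J], hence is
   orthogonal to the difference of two solutions. *)
Lemma least_norm_sol_le (k l : nat) (J : 'M[R]_(k, l)) (r : 'cV[R]_k)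
    (u : 'cV[R]_l) :
  J *m J^T \in unitmx -> J *m u = r -> fnorm (least_norm_sol J r) <= fnorm u.
Proof.
move=> JJu Ju; set v := least_norm_sol J r.
rewrite -(ler_pXn2r (n := 2)) ?nnegrE ?fnorm_ge0 //.
have Jd0 : J *m (u - v) = 0 by rewrite mulmxBr Ju least_norm_solP // subrr.
have vd0 : v^T *m (u - v) = 0.
  have -> : v^T = (invmx (J *m J^T) *m r)^T *m J.
    by rewrite /v /least_norm_sol -mulmxA trmx_mul trmxK.
  by rewrite -mulmxA Jd0 mulmx0.
have dv0 : (u - v)^T *m v = 0.
  by apply: trmx_inj; rewrite trmx_mul trmxK vd0 !trmx0.
have -> : u = v + (u - v) by rewrite addrC subrK.
rewrite [leRHS]fnorm_sqr_cV (raddfD trmx) /= mulmxDl !(mulmxDr _ v) vd0 dv0 addr0 add0r mxE.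
by rewrite -!fnorm_sqr_cV lerDl sqr_ge0.
Qed.

End FrobeniusNorm.

(** * Vectorization: norms and matrix-vector products in terms of [vec] and [vecS] *)

Section Vectorization.
Variable R : rcfType.

Lemma fnorm_vec_sqr (m n : nat) (X : 'M[R]_(m, n)) :
  fnorm (vec X) ^+ 2 = fnorm X ^+ 2.
Proof.
rewrite fnorm_mxcol_sqr fnorm_sqr exchange_big; apply: eq_bigr => j _.
by rewrite fnorm_sqr; apply: eq_bigr => i _; rewrite big_ord1 mxE.
Qed.

Lemma vec_inj (m n : nat) : injective (@vec R m n).
Proof.
move=> X Y XY; apply/matrixP => i j.
have := congr1 (fun a => submxcol a j) XY; rewrite /vec !mxcolK => /colP/(_ i).
by rewrite !mxE.
Qed.

Lemma vec_surj (m n : nat) (a : 'cV[R]_(vec_size m n)) :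
  {X : 'M[R]_(m, n) | vec X = a}.
Proof.
exists (\matrix_(i, j) submxcol a j i 0); rewrite -[RHS]submxcolK.
by apply: eq_mxcol => j; apply/colP => i; rewrite !mxE.
Qed.

Lemma vec_hadamard (m n : nat) (X S : 'M[R]_(m, n)) :
  vec (hadamard X S) = diag_mx (vec S)^T *m vec X.
Proof. by apply/colP => i; rewrite mul_diag_mx !mxE mulrC. Qed.

Lemma Mmx_vec (a b : nat) (x : 'cV[R]_b) (X : 'M[R]_(a, b)) :
  Mmx a x *m vec X = X *m x.
Proof.
rewrite mul_mxrow_mxcol; apply/colP => i; rewrite summxE mxE.
by apply: eq_bigr => j _; rewrite mul_scalar_mx !mxE mulrC.
Qed.

Lemma Nmx_vec (a b : nat) (y : 'cV[R]_a) (X : 'M[R]_(a, b)) :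
  Nmx b y *m vec X = X^T *m y.
Proof.
rewrite mul_mxrow_mxcol; apply/colP => i; rewrite summxE.
rewrite (bigD1 i) //= big1 => [|j ji].
  by rewrite addr0 !mxE; apply: eq_bigr => c _; rewrite !mxE eqxx mulrC.
by rewrite mxE big1 // => c _; rewrite !mxE eq_sym (negPf ji) mul0r.
Qed.

(** Trades the dependent offset range ['I_(k - i)] for a filtered sum over all rows, in which sums
    for different [i] can be exchanged and compared. *)
Lemma sum_low_ord (k : nat) (i : 'I_k) (F : 'I_k -> R) :
  \sum_(c < k - i) F (low_ord c) = \sum_(r < k | (i <= r)%N) F r.
Proof.
symmetry; have hr (r : 'I_k) : (i <= r)%N -> (r - i < k - i)%N.
  by move=> ir; rewrite ltn_sub2r // (leq_ltn_trans ir).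
have c0 : (0 < k - i)%N by rewrite subn_gt0.
(* Inverse of [low_ord]; the default [Ordinal c0] is never reached on rows [r >= i], by [hr]. *)
pose h (r : 'I_k) : 'I_(k - i) := insubd (Ordinal c0) (r - i)%N.
rewrite (reindex (@low_ord k i)) /=.
  by apply: eq_bigl => c; rewrite leq_addr.
exists h => [c _|r ir]; apply: val_inj; rewrite /= val_insubd /=.
  by rewrite addKn ltn_ord.
by rewrite hr // subnKC.
Qed.

Lemma vecS_hadamard (k : nat) (X S : 'M[R]_k) :
  vecS (hadamard X S) = diag_mx (vecS S)^T *m vecS X.
Proof. by apply/colP => i; rewrite mul_diag_mx !mxE mulrC. Qed.

Lemma vecS_low (k : nat) (X Y : 'M[R]_k) (i j : 'I_k) :
  vecS X = vecS Y -> (i <= j)%N -> X j i = Y j i.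
Proof.
move=> XY ij; have hc : (j - i < k - i)%N.
  by rewrite ltn_sub2r // (leq_ltn_trans ij).
have := congr1 (fun a => submxcol a i) XY.
rewrite /vecS !mxcolK => /colP/(_ (Ordinal hc)); rewrite !mxE.
by have -> : low_ord (Ordinal hc) = j by apply: val_inj; rewrite /= subnKC.
Qed.

Lemma vecS_inj_sym (k : nat) (X Y : 'M[R]_k) :
  X^T = X -> Y^T = Y -> vecS X = vecS Y -> X = Y.
Proof.
move=> symX symY XY; apply/matrixP => j i; have [ij|/ltnW ij] := leqP i j.
  exact: vecS_low XY ij.
by rewrite -symX -symY !mxE; exact: vecS_low XY ij.
Qed.

Lemma vecS_surj (k : nat) (a : 'cV[R]_(svec_size k)) :
  {X : 'M[R]_k | X^T = X & vecS X = a}.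
Proof.
(* Reads the entry at offset [j - i] of block [i]. The default [0] is never reached below: [L j i]
   is evaluated only for [i <= j], where [j - i < k - i]. *)
pose L (j i : 'I_k) : R :=
  if insub (j - i)%N is Some c then submxcol a i c 0 else 0.
exists (\matrix_(j, i) (if (i <= j)%N then L j i else L i j)).
  apply/matrixP => j i; rewrite !mxE.
  by case: ltngtP => // /val_inj ->.
rewrite -[RHS]submxcolK; apply: eq_mxcol => i; apply/colP => c.
rewrite mxE mxE leq_addr /L /= addKn; case: insubP => [c' _ cc'|].
  by rewrite (val_inj cc').
by rewrite ltn_ord.
Qed.

Lemma Kmx_vecS (k : nat) (x : 'cV[R]_k) (X : 'M[R]_k) :
  X^T = X -> Kmx x *m vecS X = X *m x.
Proof.
move=> symX; have sX i j : X i j = X j i by rewrite -[in LHS]symX mxE.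
rewrite mul_mxrow_mxcol; apply/colP => r; rewrite summxE.
(* Row [r] of [Kblock x i], with each column named by the row index [s = i + c] of the entry of [X]
   it multiplies instead of the offset [c]. *)
pose G (i s : 'I_k) := if (r < i)%N then 0
  else if r == i then x s 0 else if s == r then x i 0 else 0.
have KE i : (Kblock x i *m (\col_c X (low_ord c) i)) r 0
          = \sum_(s < k | (i <= s)%N) G i s * X s i.
  rewrite -(@sum_low_ord k i (fun s => G i s * X s i)) mxE.
  apply: eq_bigr => c _; rewrite !mxE; congr (_ * _).
  rewrite /G; case: ltnP => // ir; case: eqP => // _.
  by rewrite -(inj_eq val_inj) /= -(eqn_add2l i) subnKC.
(* Row [r] of [X x] is cut at [s = r]: the terms with [s >= r] all come from block [r], each term
   with [s < r] is the single nonzero contribution of block [s], and blocks beyond [r] vanish in row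
   [r]. *)
rewrite (eq_bigr _ (fun i _ => KE i)) mxE [RHS](bigID (fun s : 'I_k => r <= s)%N) /=.
rewrite (bigD1 r) //=; congr (_ + _).
  apply: eq_bigr => s rs; rewrite /G ltnn eqxx mulrC sX //.
rewrite [RHS]big_mkcond [LHS]big_mkcond; apply: eq_bigr => i _.
have [ir|ri|/val_inj ->] := ltngtP i r; last by rewrite eqxx.
  rewrite neq_ltn ir /= (bigD1 r) 1?ltnW //= big1 => [|s /andP[_ sr]].
    rewrite addr0 /G ltnNge (ltnW ir) eqxx /= -(inj_eq val_inj) /=.
    by rewrite gtn_eqF // mulrC.
  rewrite /G ltnNge (ltnW ir) (negPf sr) /= -(inj_eq val_inj) /=.
  by rewrite gtn_eqF // mul0r.
by rewrite neq_ltn ri orbT /= big1 // => s _; rewrite /G ri mul0r.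
Qed.

Lemma DS_unitmx (k : nat) : DS R k \in unitmx.
Proof.
rewrite unitmxE det_diag unitfE; apply/prodf_neq0 => i _.
by rewrite !mxE; case: ifP; rewrite ?oner_eq0 // sqrtr_eq0 -ltNge ltr0n.
Qed.

(* An off-diagonal entry of a symmetric matrix occurs twice in the Frobenius
   norm but once in [vecS], whence the factor sqrt 2 in [DS]. *)
Lemma fnorm_DS_vecS_sqr (k : nat) (X : 'M[R]_k) :
  X^T = X -> fnorm (DS R k *m vecS X) ^+ 2 = fnorm X ^+ 2.
Proof.
move=> symX; have sX i j : X i j = X j i by rewrite -[in LHS]symX mxE.
rewrite -vecS_hadamard fnorm_mxcol_sqr fnorm_sqr.
pose F (i r : 'I_k) := (if r == i then 1 else 2) * X r i ^+ 2.
have -> : \sum_(i < k) fnorm (\col_(c < k - i) (hadamard X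
     (\matrix_(r, c0) (if r == c0 then 1 else Num.sqrt 2))) (low_ord c) i) ^+ 2
   = \sum_(i < k) \sum_(r < k | (i <= r)%N) F i r.
  apply: eq_bigr => i _; rewrite fnorm_sqr -sum_low_ord; apply: eq_bigr => c _.
  rewrite big_ord1 !mxE exprMn mulrC /F; congr (_ * _).
  by case: ifP; rewrite ?expr1n // sqr_sqrtr.
(* Symmetry folds the strict lower triangle onto the strict upper one, so each off-diagonal square
   is counted twice. *)
have -> : \sum_i \sum_j X i j ^+ 2 =
   \sum_(i < k) \sum_(j < k | (i <= j)%N) X i j ^+ 2 +
   \sum_(i < k) \sum_(j < k | (i < j)%N) X i j ^+ 2.
  under eq_bigr => i _ do rewrite (bigID (fun j : 'I_k => (i <= j)%N)) /=.
  rewrite big_split /=; congr (_ + _).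
  rewrite (exchange_big_dep xpredT) //=; apply: eq_bigr => i _.
  by apply: eq_big => [j|j _]; rewrite ?ltnNge // sX.
rewrite -big_split; apply: eq_bigr => i _ /=.
rewrite [X in _ + X](bigID (fun j : 'I_k => (i <= j)%N)) /=.
rewrite [X in _ + (_ + X)]big1 ?addr0.
  rewrite [X in _ + X]big_mkcond [X in X + _]big_mkcond [LHS]big_mkcond /=.
  rewrite -big_split.
  apply: eq_bigr => j _ /=; rewrite /F (sX j i) ltn_neqAle.
  have [->|ij] := eqVneq j i; first by rewrite eqxx leqnn /= mul1r addr0.
  rewrite -(inj_eq val_inj) eq_sym /= in ij; rewrite ij /= andbb.
  by case: ifP; rewrite ?addr0 // mulrDl !mul1r.
by move=> j /andP[/ltnW ->].
Qed.

End Vectorization.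

(** * Encoding and decoding of a single weighted, sparsity-constrained block *)

Section SparsityBlocks.
Variable R : rcfType.

Lemma diag_mx_mask (k : nat) (b : 'I_k -> bool) (d : 'rV[R]_k) :
  (forall i, d 0 i = (b i)%:R) -> diag_mx d *m diag_mx d = diag_mx d.
Proof.
move=> db; apply/matrixP => i j; rewrite mul_diag_mx !mxE db.
by case: (b i); rewrite ?mul1r ?mul0r //= mul0rn.
Qed.

Lemma Phi_idem (m n : nat) (X : 'M[R]_(m, n)) : Phi X *m Phi X = Phi X.
Proof.
apply: (@diag_mx_mask _ (fun i => X (tagnat.sig2 i) (tagnat.sig1 i) != 0)).
by move=> i; rewrite !mxE.
Qed.

Lemma PhiS_idem (k : nat) (X : 'M[R]_k) : PhiS X *m PhiS X = PhiS X.
Proof.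
apply: (@diag_mx_mask _
  (fun i => X (low_ord (tagnat.sig2 i)) (tagnat.sig1 i) != 0)).
by move=> i; rewrite !mxE.
Qed.

Lemma Phi_vec (m n : nat) (B X : 'M[R]_(m, n)) :
  Phi B *m vec X = vec X <-> X = hadamard X (Theta B).
Proof.
rewrite /Phi -vec_hadamard; split=> [|<- //].
by move/esym/vec_inj.
Qed.

Lemma hadamard_sym (k : nat) (X Y : 'M[R]_k) :
  X^T = X -> Y^T = Y -> (hadamard X Y)^T = hadamard X Y.
Proof. by move=> {2}<- {2}<-; apply/matrixP => i j; rewrite !mxE. Qed.

Lemma Theta_sym (k : nat) (X : 'M[R]_k) : X^T = X -> (Theta X)^T = Theta X.
Proof. by move=> {2}<-; apply/matrixP => i j; rewrite !mxE. Qed.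

(** The mask acts on the lower triangle only; symmetry of both [A] and [X] carries the pattern over
    to the upper triangle. *)
Lemma PhiS_vecS (k : nat) (A X : 'M[R]_k) : A^T = A -> X^T = X ->
  PhiS A *m vecS X = vecS X <-> X = hadamard X (Theta A).
Proof.
move=> symA symX; rewrite /PhiS -vecS_hadamard; split=> [|<- //].
by move=> eqX; apply: vecS_inj_sym; rewrite ?hadamard_sym ?Theta_sym.
Qed.

(** Since [0^-1 = 0], scaling by a zero weight loses [X]; the premise is the convention that such a
    block is unperturbed. *)
Lemma scale_invrK (m n : nat) (t : R) (X : 'M[R]_(m, n)) :
  (t = 0 -> X = 0) -> t^-1 *: (t *: X) = X.
Proof.
have [-> X0|t0 _] := eqVneq t 0; first by rewrite X0 // !scaler0.
by rewrite scalerA mulVf // scale1r.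
Qed.

Lemma scale_divrK (m n : nat) (t : R) (X : 'M[R]_(m, n)) :
  (t = 0 -> X = 0) -> t *: (t^-1 *: X) = X.
Proof.
have [-> X0|t0 _] := eqVneq t 0; first by rewrite X0 // !scaler0.
by rewrite scalerA mulfV // scale1r.
Qed.

Lemma invmx_diag (k : nat) (d : 'rV[R]_k) : diag_mx d \in unitmx ->
  invmx (diag_mx d) = diag_mx (\row_i (d 0 i)^-1).
Proof.
move=> du; apply: (can_inj (mulKmx du)); rewrite mulmxV //.
move: du; rewrite unitmxE det_diag unitfE => /prodf_neq0 d0.
apply/matrixP => i j; rewrite mul_diag_mx !mxE.
by case: eqVneq => [->|]; rewrite ?mulr0 //= mulr1n mulfV ?d0.
Qed.

Lemma invmx_DS_PhiSC (k : nat) (A : 'M[R]_k) :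
  invmx (DS R k) *m PhiS A = PhiS A *m invmx (DS R k).
Proof. by rewrite /DS invmx_diag ?DS_unitmx // diag_mxC. Qed.

Lemma tr_invmx_DS (k : nat) : (invmx (DS R k))^T = invmx (DS R k).
Proof. by rewrite trmx_inv tr_diag_mx. Qed.

Section SymmetricBlock.
Variables (k : nat) (A : 'M[R]_k) (t : R).
Hypothesis symA : A^T = A.

Definition encS (X : 'M[R]_k) : 'cV[R]_(svec_size k) :=
  t *: (DS R k *m vecS X).

Definition feasibleS (X : 'M[R]_k) : Prop :=
  [/\ X^T = X, X = hadamard X (Theta A) & t = 0 -> X = 0].

Lemma fnorm_encS (X : 'M[R]_k) :
  X^T = X -> fnorm (encS X) ^+ 2 = t ^+ 2 * fnorm X ^+ 2.
Proof. by move=> symX; rewrite fnorm_scale_sqr fnorm_DS_vecS_sqr. Qed.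

Lemma Kmx_encS (x : 'cV[R]_k) (X : 'M[R]_k) : feasibleS X ->
  t^-1 *: (Kmx x *m PhiS A *m invmx (DS R k)) *m encS X = X *m x.
Proof.
move=> [symX spX X0]; rewrite -scalemxAl -scalemxAr scale_invrK; last first.
  move=> /X0 ->; rewrite [vecS _](_ : _ = 0) ?mulmx0 //.
  by apply/colP => i; rewrite !mxE.
rewrite -!mulmxA mulKmx ?DS_unitmx // (PhiS_vecS symA symX).2 //.
exact: Kmx_vecS.
Qed.

(** The vector [v] has the shape of a symmetric block of a vector in the range of [J^T]. The factor
    [t^-1] makes it zero when [t = 0], and the factor [PhiS A] makes the decoded matrix sparse. *)
Lemma encS_surj (s : 'cV[R]_(svec_size k)) :
  let v := t^-1 *: (invmx (DS R k) *m (PhiS A *m s)) in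
  exists X, [/\ feasibleS X, encS X = v &
                vecS X = t^-1 *: (invmx (DS R k) *m v)].
Proof.
move=> v; have [X symX vX] := vecS_surj (t^-1 *: (invmx (DS R k) *m v)).
exists X; have v0 : t = 0 -> v = 0 by move=> t0; rewrite /v t0 invr0 scale0r.
split=> //; last first.
  by rewrite /encS vX -scalemxAr mulKVmx ?DS_unitmx // scale_divrK.
split=> // [|/v0 v0'].
  apply/(PhiS_vecS symA symX); rewrite vX /v.
  (* [PhiS A] commutes with [invmx (DS R k)], both being diagonal, so it can be moved next to the
     copy inside [v] and absorbed by idempotence. *)
  rewrite -!(scalemxAr, scalemxAl) !mulmxA -!invmx_DS_PhiSC.
  rewrite -(mulmxA (invmx _) (PhiS A)) -invmx_DS_PhiSC -!mulmxA.
  by rewrite (mulmxA (PhiS A)) PhiS_idem.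
apply: vecS_inj_sym; rewrite ?trmx0 // vX v0' mulmx0 scaler0.
by apply/colP => i; rewrite !mxE.
Qed.

End SymmetricBlock.

Section GeneralBlock.
Variables (m n : nat) (B : 'M[R]_(m, n)) (t : R).

Definition enc (X : 'M[R]_(m, n)) : 'cV[R]_(vec_size m n) := t *: vec X.

Definition feasible (X : 'M[R]_(m, n)) : Prop :=
  X = hadamard X (Theta B) /\ (t = 0 -> X = 0).

Lemma fnorm_enc (X : 'M[R]_(m, n)) :
  fnorm (enc X) ^+ 2 = t ^+ 2 * fnorm X ^+ 2.
Proof. by rewrite fnorm_scale_sqr fnorm_vec_sqr. Qed.

Lemma Phi_enc (X : 'M[R]_(m, n)) :
  feasible X -> t^-1 *: (Phi B *m enc X) = vec X.
Proof.
move=> [spX X0]; rewrite -scalemxAr (Phi_vec B X).2 // scale_invrK //.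
by move=> /X0 ->; apply/colP => i; rewrite !mxE.
Qed.

Lemma Mmx_enc (x : 'cV[R]_n) (X : 'M[R]_(m, n)) : feasible X ->
  t^-1 *: (Mmx m x *m Phi B) *m enc X = X *m x.
Proof. by move=> /Phi_enc eX; rewrite -scalemxAl -mulmxA scalemxAr eX Mmx_vec. Qed.

Lemma Nmx_enc (y : 'cV[R]_m) (X : 'M[R]_(m, n)) : feasible X ->
  t^-1 *: (Nmx n y *m Phi B) *m enc X = X^T *m y.
Proof. by move=> /Phi_enc eX; rewrite -scalemxAl -mulmxA scalemxAr eX Nmx_vec. Qed.

Lemma enc_surj (s : 'cV[R]_(vec_size m n)) :
  let v := t^-1 *: (Phi B *m s) in
  exists X, [/\ feasible X, enc X = v & vec X = t^-1 *: v].
Proof.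
move=> v; have [X vX] := vec_surj (t^-1 *: v).
have v0 : t = 0 -> v = 0 by move=> t0; rewrite /v t0 invr0 scale0r.
exists X; split=> //; last by rewrite /enc vX scale_divrK.
split=> [|/v0 v0'].
  by apply/Phi_vec; rewrite vX -!scalemxAr mulmxA Phi_idem.
by apply: vec_inj; rewrite vX v0' scaler0; apply/colP => i; rewrite !mxE.
Qed.

End GeneralBlock.
End SparsityBlocks.

(** * Assembly of the blocks into the linear system [J u = R] *)

Section DoubleSaddlePoint.
Variables (R : rcfType) (n m p : nat) (P : dsp R n m p) (w : weights R).
Variables (x : 'cV[R]_n) (y : 'cV[R]_m) (z : 'cV[R]_p).

Definition pert_vec (Q : dsp R n m p) :=
  stack8 (encS (th1 w) (blkA Q)) (enc (th2 w) (blkB Q)) (encS (th4 w) (blkC Q))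
         (enc (th5 w) (blkD Q)) (encS (th7 w) (blkE Q))
         (th8 w *: rhsf Q) (th9 w *: rhsg Q) (th10 w *: rhsh Q).

Definition feasible_blocks (Q : dsp R n m p) : Prop :=
  [/\ feasibleS (blkA P) (th1 w) (blkA Q), feasible (blkB P) (th2 w) (blkB Q),
      feasibleS (blkC P) (th4 w) (blkC Q), feasible (blkD P) (th5 w) (blkD Q) &
      feasibleS (blkE P) (th7 w) (blkE Q)].

(** The perturbation terms of the system, all moved to the left; the minus signs on the right-hand
    sides are those of [Icalmx]. *)
Definition pert_action (Q : dsp R n m p) : 'cV[R]_(n + m + p) :=
  stack3 (blkA Q *m x + (blkB Q)^T *m y - rhsf Q)
         (blkB Q *m x - blkC Q *m y + (blkD Q)^T *m z - rhsg Q)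
         (blkD Q *m y + blkE Q *m z - rhsh Q).

Lemma perturbed_systemE (Q : dsp R n m p) :
  coefmx (dsp_add P Q) *m stack3 x y z = rhs (dsp_add P Q) <->
  pert_action Q = residual P x y z.
Proof.
have diffE : coefmx (dsp_add P Q) *m stack3 x y z - rhs (dsp_add P Q) =
             pert_action Q - residual P x y z.
  rewrite !mul_block_col mul_col_mx mul_row_col !add_col_mx !mul0mx addr0 add0r.
  rewrite !opp_col_mx !add_col_mx !(raddfD trmx) /= !opprD !mulmxDl !mulNmx.
  (* Once the matrix products are abstracted, each block row is an entrywise ring identity. *)
  by congr (col_mx (col_mx _ _) _); do !move: (_ *m _) => ?;
    apply/colP => i; rewrite !mxE; ring.
by split=> /eqP; rewrite -subr_eq0; [rewrite diffE | rewrite -diffE];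
  rewrite subr_eq0 => /eqP.
Qed.

(** Feasibility is what lets the factors [1/theta] and [Phi] of [Jmx] undo the weights in
    [pert_vec]: the masks fix the blocks, and blocks of zero weight are zero. *)
Lemma Jmx_pert_vec (Q : dsp R n m p) :
  (blkA P)^T = blkA P -> (blkC P)^T = blkC P -> (blkE P)^T = blkE P ->
  th8 w != 0 -> th9 w != 0 -> th10 w != 0 -> feasible_blocks Q ->
  Jmx P w x y z *m pert_vec Q = pert_action Q.
Proof.
move=> symA symC symE t8 t9 t10 [fA fB fC fD fE].
rewrite /Jmx /Icalmx /pert_vec /stack8 /stack3 mul_row_col !mul_col_mx.
rewrite !mul_row_col !mul_block_col !mul0mx !(addr0, add0r).
rewrite !mulNmx.
rewrite Kmx_encS // Nmx_enc // Mmx_enc // Kmx_encS // Nmx_enc //.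
rewrite Mmx_enc // Kmx_encS //.
by rewrite !mul_scalar_mx !scalerA !mulNr !mulVf // !scaleN1r !add_col_mx.
Qed.

Lemma row_free_Jmx :
  th8 w != 0 -> th9 w != 0 -> th10 w != 0 -> row_free (Jmx P w x y z).
Proof.
move=> t8 t9 t10; apply/row_freeP.
(* A right inverse: zero against [Jtilde], and the inverse of [Icalmx] below. *)
exists (col_mx 0 (block_mx (block_mx (- th8 w)%:M 0 0 (- th9 w)%:M) 0
                            0 (- th10 w)%:M)).
rewrite mul_row_col mulmx0 add0r /Icalmx !mulmx_block !(mulmx0, mul0mx, addr0, add0r).
by rewrite -!scalar_mxM !mulrNN !mulVf // -!scalar_mx_block.
Qed.

Lemma pert_normE (Q : dsp R n m p) : feasible_blocks Q ->
  pert_norm w Q = fnorm (pert_vec Q).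
Proof.
move=> [[symA _ _] _ [symC _ _] _ [symE _ _]].
apply/eqP; rewrite -(eqrXn2 (n := 2)) ?fnorm_ge0 ?sqrtr_ge0 //; apply/eqP.
rewrite !fnorm_col_mx_sqr !fnorm_encS // !fnorm_enc !fnorm_scale_sqr.
rewrite sqr_sqrtr ?addrA //.
by rewrite -!exprMn !addr_ge0 ?sqr_ge0.
Qed.

Lemma admissibleE (Q : dsp R n m p) :
  th8 w != 0 -> th9 w != 0 -> th10 w != 0 ->
  admissible P w x y z Q <->
  feasible_blocks Q /\ pert_action Q = residual P x y z.
Proof.
move=> /eqP t8 /eqP t9 /eqP t10; rewrite -perturbed_systemE; split.
  by move=> [[? ? ? ?] [? ? ? ? ?] [[? ? ? ? ?] _]]; split=> //; split.
(* The zero-weight clauses on [rhsf], [rhsg] and [rhsh] are vacuous, their weights being nonzero. *)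
by move=> [[[? ? ?] [? ?] [? ? ?] [? ?] [? ? ?]] ?]; do !split.
Qed.

(* Every vector in the range of [J^T] encodes a feasible perturbation, because
   its blocks carry the factors [1/theta] and [Phi]. *)
Lemma tr_Jmx_mul (q : 'cV[R]_(n + m + p)) :
  exists s1 s2 s3 s4 s5 s6 s7 s8,
  (Jmx P w x y z)^T *m q =
  stack8 ((th1 w)^-1 *: (invmx (DS R n) *m (PhiS (blkA P) *m s1)))
         ((th2 w)^-1 *: (Phi (blkB P) *m s2))
         ((th4 w)^-1 *: (invmx (DS R m) *m (PhiS (blkC P) *m s3)))
         ((th5 w)^-1 *: (Phi (blkD P) *m s4))
         ((th7 w)^-1 *: (invmx (DS R p) *m (PhiS (blkE P) *m s5)))
         s6 s7 s8.
Proof.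
rewrite -[q]vsubmxK -[usubmx q]vsubmxK.
move: (usubmx (usubmx q)) (dsubmx (usubmx q)) (dsubmx q) => q1 q2 q3.
(* The witnesses are read off the transposed block columns of [Jmx]; [B] and [D] each occur in two
   block rows, hence the sums. *)
exists ((Kmx x)^T *m q1), ((Nmx n y)^T *m q1 + (Mmx m x)^T *m q2).
exists (- ((Kmx y)^T *m q2)), ((Nmx m z)^T *m q2 + (Mmx p y)^T *m q3).
exists ((Kmx z)^T *m q3), (- (th8 w)^-1 *: q1), (- (th9 w)^-1 *: q2).
exists (- (th10 w)^-1 *: q3).
rewrite /Jmx /Icalmx /block_mx !(tr_row_mx, tr_col_mx) !trmx0 !tr_scalar_mx.
rewrite !(mul_col_mx, mul_row_col) !mul0mx !add_col_mx !(addr0, add0r).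
have trZ a k l (X : 'M[R]_(k, l)) : (a *: X)^T = a *: X^T by exact: linearZ.
rewrite !mul_scalar_mx !(raddfN trmx) /= !trZ !trmx_mul !tr_invmx_DS !tr_diag_mx.
by rewrite !mulNmx -!scalemxAl !mulmxDr !scalerDr !mulmxN !scalerN !mulmxA.
Qed.

End DoubleSaddlePoint.

(** * The backward error formula and a minimal perturbation *)

Theorem theorem3p1 (R : rcfType) (n m p : nat)
    (A : 'M[R]_n) (B : 'M[R]_(m, n)) (C : 'M[R]_m) (D : 'M[R]_(p, m))
    (E : 'M[R]_p) (f : 'cV[R]_n) (g : 'cV[R]_m) (h : 'cV[R]_p)
    (x : 'cV[R]_n) (y : 'cV[R]_m) (z : 'cV[R]_p)
    (t1 t2 t4 t5 t7 t8 t9 t10 : R) :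
  let P := DSP A B C D E f g h in
  let w := Weights t1 t2 t4 t5 t7 t8 t9 t10 in
  let J := Jmx P w x y z in
  let v := J^T *m invmx (J *m J^T) *m residual P x y z in
  A^T = A -> C^T = C -> E^T = E ->
  coefmx P \in unitmx ->
  0 <= t1 -> 0 <= t2 -> 0 <= t4 -> 0 <= t5 -> 0 <= t7 ->
  0 <= t8 -> 0 <= t9 -> 0 <= t10 ->
  t8 != 0 -> t9 != 0 -> t10 != 0 ->
  [/\ J *m J^T \in unitmx,
      sps_backward_error P w x y z (fnorm v) &
      exists v1 v2 v3 v4 v5 v6 v7 v8,
        v = stack8 v1 v2 v3 v4 v5 v6 v7 v8 /\
        exists2 Q : dsp R n m p,
          [/\ vecS (blkA Q) = t1^-1 *: (invmx (DS R n) *m v1),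
              vec (blkB Q) = t2^-1 *: v2,
              vecS (blkC Q) = t4^-1 *: (invmx (DS R m) *m v3),
              vec (blkD Q) = t5^-1 *: v4 &
              vecS (blkE Q) = t7^-1 *: (invmx (DS R p) *m v5)] /\
          [/\ rhsf Q = t8^-1 *: v6, rhsg Q = t9^-1 *: v7 &
              rhsh Q = t10^-1 *: v8]
        & minimal_perturbation P w x y z Q].
Proof.
move=> P w J v symA symC symE _ _ _ _ _ _ _ _ _ nz8 nz9 nz10.
have JJu : J *m J^T \in unitmx by apply: gram_unitmx; apply: row_free_Jmx.
have Jv : J *m v = residual P x y z by apply: least_norm_solP.
have minv u : J *m u = residual P x y z -> fnorm v <= fnorm u.
  exact: least_norm_sol_le.
(* As [J^T] applied to [(J J^T)^-1 R], the vector [v] has blocks that [encS_surj] and [enc_surj] can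
   decode. *)
have [s1 [s2 [s3 [s4 [s5 [v6 [v7 [v8]]]]]]]] :=
  tr_Jmx_mul P w x y z (invmx (J *m J^T) *m residual P x y z).
rewrite mulmxA -/J -/v /=.
have [dA [fA eA vA]] := encS_surj t1 symA s1.
have [dB [fB eB vB]] := enc_surj B t2 s2.
have [dC [fC eC vC]] := encS_surj t4 symC s3.
have [dD [fD eD vD]] := enc_surj D t5 s4.
have [dE [fE eE vE]] := encS_surj t7 symE s5.
move=> defv; pose Q := DSP dA dB dC dD dE (t8^-1 *: v6) (t9^-1 *: v7) (t10^-1 *: v8).
have fQ : feasible_blocks P w Q by [].
have eQ : pert_vec w Q = v.
  by rewrite defv /pert_vec /= eA eB eC eD eE !scalerA !mulfV // !scale1r.
have normQ : pert_norm w Q = fnorm v by rewrite -eQ (pert_normE fQ).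
have minQ : minimal_perturbation P w x y z Q.
  have admE Q' : admissible P w x y z Q' <->
      feasible_blocks P w Q' /\ pert_action x y z Q' = residual P x y z.
    exact: admissibleE.
  split=> [|Q' /admE[fQ' actQ']].
    by apply/admE; split=> //; rewrite -(@Jmx_pert_vec _ _ _ _ P w) // eQ.
  by rewrite normQ (pert_normE fQ') minv // Jmx_pert_vec.
split=> //; first by exists Q.
(* Unification with [defv] fixes the eight blocks of [v]; the required formulas are then [vA] to
   [vE] and the definition of [Q]. *)
by do 8 eexists; split; [exact: defv | exists Q].
Qed.
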